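(* Let $\alpha>-1$, $\beta\in\mathbb{R}$, $k^2\in(0,1)$, and let $\mathsf{p}_1(n)$ be the coefficient of the sub-leading term $x^{n-2}$ in the monic polynomial $P_n(x)$ orthogonal with respect to $w(x,k^2)=(1-x^2)^{\alpha}(1-k^2x^2)^{\beta}$ on $[-1,1]$. Then $\mathsf{p}_1(n)$ satisfies the following second order non-linear difference equation: $$\begin{aligned} 0={}&k^4\big(\alpha+\beta+n-\tfrac32\big)\big(\alpha+\beta+n+\tfrac12\big)^2\Big[\mathsf{p}_1(n+1)^2\big(\mathsf{p}_1(n)-\mathsf{p}_1(n-1)\big)-\mathsf{p}_1(n-1)^2\big(\mathsf{p}_1(n)-\mathsf{p}_1(n+1)\big)\Big]\\ &+\big(\alpha+\beta+n-\tfrac12\big)^2\Big[k^2\big(\alpha+\beta+n-\tfrac32\big)\mathsf{p}_1(n-1)-k^2\big(\alpha+\beta+n+\tfrac12\big)\mathsf{p}_1(n+1)-\big(\beta+n-\tfrac12\big)k^2-\alpha-n+\tfrac12\Big]k^2\mathsf{p}_1(n)^2\\ &+\big(\alpha+\beta+n+\tfrac12\big)\big(\alpha+\beta+n-\tfrac32\big)k^4\,\mathsf{p}_1(n+1)\mathsf{p}_1(n)\mathsf{p}_1(n-1)\\ &+k^2\big(\alpha+\beta+n+\tfrac12\big)\big(\alpha+\beta+n-\tfrac32\big)\Big[\big(\beta+n-\tfrac12\big)k^2+\alpha+n-\tfrac12\Big]\Big(\mathsf{p}_1(n+1)\mathsf{p}_1(n)+\mathsf{p}_1(n)\mathsf{p}_1(n-1)-\mathsf{p}_1(n+1)\mathsf{p}_1(n-1)\Big)\\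 &+(\alpha k^2+\beta)\Big[\big(\alpha+\beta+n+\tfrac12\big)\mathsf{p}_1(n+1)-\big(\alpha+\beta+n-\tfrac32\big)\mathsf{p}_1(n-1)\Big]k^2\mathsf{p}_1(n)\\ &+\frac{n-1}2\big(\alpha+\beta+n+\tfrac12\big)\big(\alpha+\beta+\tfrac n2-\tfrac12\big)k^2\mathsf{p}_1(n+1)-\frac n2\big(\alpha+\beta+n-\tfrac32\big)\big(\alpha+\beta+\tfrac n2\big)k^2\mathsf{p}_1(n-1)\\ &+\Big[\alpha\big(\beta+n-\tfrac12\big)k^4+\tfrac12\big(\alpha-\beta+n-\tfrac12\big)\big(\alpha-\beta-n+\tfrac12\big)k^2+\beta\big(\alpha+n-\tfrac12\big)\Big]\mathsf{p}_1(n)\\ &+\tfrac14n(n-1)(\alpha k^2+\beta). \end{aligned}$$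
   Context: For $\alpha>-1$, $\beta\in\mathbb{R}$, $k^2\in(0,1)$, the weight is $w(x,k^2)=(1-x^2)^{\alpha}(1-k^2x^2)^{\beta}$, $x\in[-1,1]$. For $n\ge0$, $P_n$ is the monic polynomial of degree $n$ with $\int_{-1}^1 P_i(x)P_j(x)w(x,k^2)\,dx=h_j\delta_{i,j}$. As $w$ is even, $P_n(x)=x^n+\mathsf{p}_1(n)x^{n-2}+\dots+P_n(0)$, with $\mathsf{p}_1(0)=\mathsf{p}_1(1):=0$. The quantity $\mathsf{p}_1(n)$ depends on $k^2,\alpha,\beta$; this dependence is not displayed.
   Formalization: The printed equation fails (e.g. α=β=0, n=3); with A=α+β+n+1/2, C=α+β+n−3/2, the first line is corrected to k⁴AC[A p₁(n+1)²(p₁(n)−p₁(n−1)) − C p₁(n−1)²(p₁(n)−p₁(n+1))], and the triple-product coefficient to 2ACk⁴; n≥1. *)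

(* Defs.v *)
From HB Require Import structures.
From mathcomp Require Import all_boot all_order all_algebra.
From mathcomp Require Import all_classical all_reals all_analysis.

Set Implicit Arguments.
Unset Strict Implicit.
Unset Printing Implicit Defensive.

Import Order.TTheory GRing.Theory Num.Theory.
Import numFieldNormedType.Exports.

Local Open Scope classical_set_scope.
Local Open Scope ring_scope.

Definition weight (R : realType) (alpha beta k x : R) : R :=
  (1 - x ^+ 2) `^ alpha * (1 - k ^+ 2 * x ^+ 2) `^ beta.

(* The integrand is Lebesgue integrable when -1 < alpha and 0 < k^2 < 1: the
   possible singularities at 1 and -1 are integrable, and the (finite) values
   that powR takes at these two points are irrelevant. *)
Definition wprod (R : realType) (alpha beta k : R) (p q : {poly R}) : R :=
  (\int[lebesgue_measure]_(x in `[(-1 : R), 1])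
     (p.[x] * q.[x] * weight alpha beta k x))%R.

(* For given parameters there is exactly one such family P. *)
Definition monic_orthogonal (R : realType) (alpha beta k : R)
    (P : nat -> {poly R}) : Prop :=
  (forall n, P n \is monic /\ size (P n) = n.+1) /\
  exists h : nat -> R,
    forall i j, wprod alpha beta k (P i) (P j) = h j * (i == j)%:R.

Definition p1 (R : realType) (P : nat -> {poly R}) (n : nat) : R :=
  if (n < 2)%N then 0 else (P n)`_(n - 2).

(* Main.v *)
Require Import Defs.
From mathcomp Require Import all_boot all_order all_algebra.
From mathcomp Require Import all_classical all_reals all_analysis.
From mathcomp Require Import ring lra measurable_realfun.

(** Write [K = k^2] and let [L f] be the integral of [f w] over the interval.
    The only analytic facts used are that [L] is a definite even functional on
    polynomials and that it satisfies a Pearson equation: with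
    [sigma = (1 - x^2) (1 - K x^2)], the function [sigma w] vanishes at both
    ends and [(sigma f w)' = (sigma f' + tau f) w] for a cubic [tau], hence
    [L (sigma f' + tau f) = 0] for every polynomial [f].

    Evenness and orthogonality give [x P_n = P_(n+1) + b_n P_(n-1)] with
    [b_n = p1 n - p1 (n+1)].  The Pearson equation gives the lowering relation
    [sigma P_n' = - B_n P_n + b_n A_n P_(n-1)], where [A_n = A0 + A2 x^2] and
    [B_n = B1 x - n K x^3].  Every coefficient is explicit in [p1]: the
    leading coefficients of the relation give the cubic term of [B_n], the
    next ones give [B1] in terms of [A2], and [B_(n+1) + B_n = x A_n - V],
    where [V] is [- sigma w' / w], gives [A2] and [A0].  Lowering
    passes from [n] to [n + 1] by the three-term recurrence, up to the constant
    term of [A_(n+1)]; the Pearson equation for [P_n P_(n+1)] identifies that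
    constant, and yields the Laguerre-Freud equation
    [b_(n+1) A0_(n+1) - b_n A0_(n-1) = 1] ([laguerre_freud]).

    Everything else is elimination.  Let [S_n] be the sum of the [A0_j] with
    [j < n].  By induction on [n] one gets [S_n = b_n A0_n A0_(n-1)], an
    expression of [K S_n] that is affine in [p1 n] and [p1 (n+1)], and an
    expression of [b_n (A0_n A2_(n-1) + A2_n A0_(n-1))] by [B1_n] and [S_n];
    these are the coefficients of the classical identity
    [B_n^2 + V B_n + sigma (A_0 + ... + A_(n-1)) = b_n A_n A_(n-1)].
    Since [A0_n] is the only quantity that involves [p1 (n+2)], eliminating
    it leaves a cubic relation between [p1 (n-1)], [p1 n] and [p1 (n+1)]
    ([ladder_elimination]), which is [8 K^2] times the announced one. *)

Set Implicit Arguments.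
Unset Strict Implicit.
Unset Printing Implicit Defensive.

Import Order.TTheory GRing.Theory Num.Theory.
Import numFieldNormedType.Exports.
Local Open Scope classical_set_scope.
Local Open Scope ring_scope.

(** * Elimination from the Laguerre-Freud equation *)

Section Elimination.
Variables (R : realFieldType) (alpha beta K : R) (p : nat -> R).

Definition rec_coef n := p n - p n.+1.

(** [ladA0 n + ladA2 n x^2] and [ladB1 n x - n K x^3] are the polynomials
    [A_n] and [B_n] of the lowering relation. *)
Definition ladA2 n : R := - K * (2 * (alpha + beta + n%:R) + 1).

Definition ladB1 n : R := n%:R * (1 + K) + 2 * K * p n + rec_coef n * ladA2 n.

Definition ladA0 n : R := ladB1 n.+1 + ladB1 n + 2 * (alpha + beta * K).

Local Notation b := rec_coef.

Hypotheses (p_0 : p 0 = 0) (p_1 : p 1 = 0).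
(* At n = 0 the junk value 0.-1 = 0 is multiplied by b 0 = 0. *)
Hypothesis laguerre_freud_hyp : forall n, b n.+1 * ladA0 n.+1 - b n * ladA0 n.-1 = 1.

Definition sumA0 n : R := \sum_(j < n) ladA0 j.

(** Closed form of the sum of the [- ladA2 j] with [j < n]. *)
Definition sumA2 n : R := 2 * K * n%:R * (alpha + beta) + K * n%:R ^+ 2.

Lemma rec_coef0 : b 0 = 0. Proof. by rewrite /rec_coef p_0 p_1 subrr. Qed.

(** The Laguerre-Freud equation, multiplied by [A0_n], telescopes. *)
Lemma sum_ladA0_prod n : sumA0 n = b n * ladA0 n * ladA0 n.-1.
Proof.
elim: n => [|n IH]; first by rewrite /sumA0 big_ord0 rec_coef0 !mul0r.
have E : b n.+1 * ladA0 n.+1 = 1 + b n * ladA0 n.-1.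
  by rewrite -(laguerre_freud_hyp n); ring.
by rewrite /sumA0 big_ord_recr /= -/(sumA0 n) IH E; ring.
Qed.

Definition scaled_sumA0 n : R :=
  b n * ladA2 n * (ladA2 n + 2 * K) - (1 + K) * sumA2 n
  + 2 * K * n%:R * (ladB1 n + alpha + beta * K)
  + 2 * K * (alpha + beta) * ladB1 n.

(** The coefficient of [x^4] in the identity
    [B_n^2 + V B_n + sigma (A_0 + ... + A_(n-1)) = b_n A_n A_(n-1)]. *)
Lemma sum_ladA0_affine n : K * sumA0 n = scaled_sumA0 n.
Proof.
rewrite /scaled_sumA0 /sumA2; elim: n => [|n IH].
  by rewrite /sumA0 big_ord0 /ladB1 /ladA2 rec_coef0 p_0; ring.
rewrite /sumA0 big_ord_recr /= -/(sumA0 n) mulrDr IH.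
by rewrite /ladA0 /ladB1 /ladA2 /rec_coef -natr1; ring.
Qed.

(** The coefficient of [x^2] in the same identity. *)
Lemma ladder_quadratic n :
  ladB1 n ^+ 2 + 2 * (alpha + beta * K) * ladB1 n
    - (1 + K) * sumA0 n - sumA2 n
  = b n * (ladA0 n * (ladA2 n + 2 * K) + ladA2 n * ladA0 n.-1).
Proof.
elim: n => [|n IH].
  by rewrite /sumA0 big_ord0 /sumA2 /ladB1 rec_coef0 p_0; ring.
have dB : ladB1 n.+1 - ladB1 n - (1 + K)
    = b n.+1 * ladA2 n.+1 - b n * (ladA2 n + 2 * K).
  by rewrite /ladB1 /ladA2 /rec_coef -natr1; ring.
have A2S : ladA2 n.+1 + 2 * K = ladA2 n by rewrite /ladA2 -natr1; ring.
have sA2S : sumA2 n.+1 = sumA2 n - ladA2 n.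
  by rewrite /sumA2 /ladA2 -natr1; ring.
rewrite /sumA0 big_ord_recr /= -/(sumA0 n) A2S sA2S.
have -> : b n.+1 * (ladA0 n.+1 * ladA2 n + ladA2 n.+1 * ladA0 n)
    = b n * (ladA0 n * (ladA2 n + 2 * K) + ladA2 n * ladA0 n.-1)
      + ladA2 n * (b n.+1 * ladA0 n.+1 - b n * ladA0 n.-1)
      + ladA0 n * (b n.+1 * ladA2 n.+1 - b n * (ladA2 n + 2 * K)) by ring.
by rewrite -IH laguerre_freud_hyp -dB /ladA0; ring.
Qed.

(** Eliminates [ladA0 n] between [sum_ladA0_prod] and [ladder_quadratic], by
    multiplying the latter by [ladA0 n.-1]; everything left is explicit in
    [p n.-1], [p n] and [p n.+1]. *)
Lemma ladder_elimination n :
  scaled_sumA0 n * (ladA2 n + 2 * K) + K * ladA2 n * b n * ladA0 n.-1 ^+ 2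
  = (K * (ladB1 n ^+ 2 + 2 * (alpha + beta * K) * ladB1 n - sumA2 n)
     - (1 + K) * scaled_sumA0 n) * ladA0 n.-1.
Proof.
rewrite -sum_ladA0_affine.
have -> : K * (ladB1 n ^+ 2 + 2 * (alpha + beta * K) * ladB1 n - sumA2 n)
    - (1 + K) * (K * sumA0 n)
    = K * (b n * (ladA0 n * (ladA2 n + 2 * K) + ladA2 n * ladA0 n.-1)).
  by rewrite -ladder_quadratic; ring.
by rewrite sum_ladA0_prod; ring.
Qed.

End Elimination.

(** * Orthogonal polynomials of an even definite functional *)

Lemma coef_comp_oppX (R : comNzRingType) (q : {poly R}) j :
  (q \Po - 'X)`_j = (-1) ^+ j * q`_j.
Proof.
elim/poly_ind: q j => [|q c IH] j; first by rewrite comp_poly0 !coef0 mulr0.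
rewrite comp_polyD comp_polyM comp_polyX comp_polyC mulrN.
rewrite coefD coefN !coefD !coefMX.
case: j => [|j] /=; first by rewrite oppr0 add0r expr0 mul1r.
by rewrite IH !coefC /= !addr0 exprS mulN1r mulNr.
Qed.

Section OrthogonalPolynomials.
Variables (R : realType) (L : {poly R} -> R) (P : nat -> {poly R}).
Hypothesis LD : forall f g, L (f + g) = L f + L g.
Hypothesis LZ : forall c f, L (c%:P * f) = c * L f.
Hypothesis L_even : forall f, L (f \Po - 'X) = L f.
Hypothesis L_definite : forall f, L (f * f) = 0 -> f = 0.
Hypothesis P_monic : forall n, P n \is monic.
Hypothesis P_size : forall n, size (P n) = n.+1.
Hypothesis P_orth : forall i j, i != j -> L (P i * P j) = 0.

Local Notation b := (rec_coef (p1 P)).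

Lemma functional0 : L 0 = 0.
Proof. by rewrite -(mulr0 0%:P) LZ mul0r. Qed.

Lemma functionalB f g : L (f - g) = L f - L g.
Proof. by have := LD (f - g) g; rewrite subrK => ->; rewrite addrK. Qed.

Lemma coef_lead n : (P n)`_n = 1.
Proof. by have := P_monic n; rewrite monicE lead_coefE P_size => /eqP. Qed.

Lemma size_sub_lead (q : {poly R}) n : (size q <= n.+1)%N ->
  (size (q - (q`_n)%:P * P n)%R <= n)%N.
Proof.
move=> sq; apply/leq_sizeP => j; rewrite leq_eqVlt => /predU1P[<-|nj].
  by rewrite coefB coefCM coef_lead mulr1 subrr.
rewrite coefB coefCM [q`_j]nth_default; last exact: leq_trans sq nj.
by rewrite [(P n)`_j]nth_default ?P_size // mulr0 subrr.
Qed.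

Lemma orth_lower n (q : {poly R}) : (size q <= n)%N -> L (q * P n) = 0.
Proof.
suff H : forall m (q : {poly R}), (size q <= m)%N -> (m <= n)%N -> L (q * P n) = 0.
  by move=> sq; apply: (H n).
elim=> [|m IH] {}q sq mn.
  by move: sq; rewrite leqn0 size_poly_eq0 => /eqP->; rewrite mul0r functional0.
rewrite -[q](subrK ((q`_m)%:P * P m)) mulrDl LD IH ?(ltnW mn) //; last first.
  exact: size_sub_lead.
by rewrite -mulrA LZ P_orth ?mulr0 ?addr0 // ltn_eqF.
Qed.

(** The reflected polynomial is orthogonal to lower degrees as well, so the
    difference of the two is orthogonal to itself. *)
Lemma orth_parity n : P n \Po - 'X = (-1) ^+ n *: P n.
Proof.
pose Q := (-1) ^+ n *: (P n \Po - 'X).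
have sQ : size Q = n.+1.
  rewrite size_scale ?signr_eq0 // size_comp_poly2 ?P_size //.
  by rewrite size_polyN size_polyX.
have cQ : Q`_n = 1.
  by rewrite coefZ coef_comp_oppX mulrA -expr2 sqrr_sign mul1r coef_lead.
have Lo (q : {poly R}) : (size q <= n)%N -> L (q * Q) = 0.
  move=> sq; rewrite -L_even comp_polyM comp_polyZ -comp_polyA.
  rewrite raddfN /= comp_polyX opprK comp_polyXr -mul_polyC mulrCA LZ.
  by rewrite orth_lower ?mulr0 // size_comp_poly2 ?size_polyN ?size_polyX.
have sd : (size (P n - Q)%R <= n)%N.
  have := @size_sub_lead Q n; rewrite cQ mul1r sQ -size_polyN opprB; exact.
have : L ((P n - Q) * (P n - Q)) = 0.
  by rewrite mulrBr functionalB orth_lower // Lo // subrr.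
move/L_definite/eqP; rewrite subr_eq0 => /eqP {2}->.
by rewrite /Q scalerA -expr2 sqrr_sign scale1r.
Qed.

Lemma coef_orth_pred n : (P n.+1)`_n = 0.
Proof.
have := congr1 (fun q : {poly R} => q`_n) (orth_parity n.+1).
rewrite coef_comp_oppX coefZ exprS mulN1r mulNr => /eqP.
by rewrite -addr_eq0 -mulr2n mulrn_eq0 /= mulf_eq0 signr_eq0 /= => /eqP.
Qed.

Lemma coef_rec_coef n : ('X * P n.+1 - P n.+2)`_n = b n.+1.
Proof.
rewrite coefB coefXM /rec_coef /p1 !subSS subn0; case: n => [|n] //=.
by rewrite !subSS !subn0.
Qed.

Lemma rec_coef_p1_0 : b 0 = 0. Proof. exact: rec_coef0. Qed.

Lemma three_term n : 'X * P n = P n.+1 + (b n)%:P * P n.-1.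
Proof.
have sT : (size ('X * P n - P n.+1)%R <= n)%N.
  apply/leq_sizeP => j; rewrite coefB coefXM leq_eqVlt => /predU1P[<-|].
    by rewrite coef_orth_pred subr0; case: n => [|n] //=; rewrite coef_orth_pred.
  rewrite leq_eqVlt => /predU1P[<-|nj] /=; first by rewrite !coef_lead subrr.
  by case: j nj => // j nj /=; rewrite !nth_default ?subrr ?P_size //; exact: ltnW.
have oT (d : {poly R}) : (size d <= n.-1)%N -> L (d * ('X * P n - P n.+1)) = 0.
  move=> sd; rewrite mulrBr functionalB [_ * (_ * P n)]mulrA orth_lower.
    rewrite orth_lower ?subrr //; apply: leq_trans sd _.
    exact: leq_trans (leq_pred _) (leqnSn _).
  case: n sd {sT} => [|n] sd.
    by move: sd => /=; rewrite leqn0 size_poly_eq0 => /eqP->; rewrite mul0r size_poly0.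
  by apply: leq_trans (size_polyMleq _ _) _; rewrite size_polyX addn2.
case: n sT oT => [|n] sT oT.
  rewrite rec_coef_p1_0 mul0r addr0; apply/eqP.
  by rewrite -subr_eq0 -size_poly_eq0 -leqn0.
have sd := @size_sub_lead _ n sT.
rewrite coef_rec_coef in sd.
set d := _ - _ in sd.
have : L (d * d) = 0.
  by rewrite {2}/d mulrBr functionalB oT // mulrCA LZ orth_lower // mulr0 subrr.
by move/L_definite/eqP; rewrite /d addrAC subr_eq0 subr_eq addrC => /eqP.
Qed.

Lemma norm_ratio n : L (P n.+1 * P n.+1) = b n.+1 * L (P n * P n).
Proof.
have E : P n.+1 = 'X * P n - (b n)%:P * P n.-1 by rewrite three_term addrK.
rewrite {2}E mulrBr functionalB [P n.+1 * (_ * P n.-1)]mulrCA LZ.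
rewrite [L (P n.+1 * P n.-1)]P_orth; last first.
  by case: n {E} => //= n; rewrite neq_ltn ltnS leqnSn orbT.
rewrite mulr0 subr0 mulrCA mulrA three_term mulrDl LD [L (P n.+2 * P n)]P_orth.
  by rewrite add0r -mulrA LZ.
by rewrite neq_ltn ltnS leqnSn orbT.
Qed.

Lemma rec_coef_norm n : b n * (b n * L (P n.-1 * P n.-1)) = b n * L (P n * P n).
Proof. by case: n => [|n]; [rewrite rec_coef_p1_0 !mul0r | rewrite norm_ratio]. Qed.

(** ** Moments of neighbouring products *)

Lemma moment1 n : L ('X * (P n * P n.+1)) = b n.+1 * L (P n * P n).
Proof.
rewrite mulrA three_term mulrDl LD norm_ratio -mulrA LZ.
rewrite [L (P n.-1 * _)]orth_lower ?mulr0 ?addr0 //.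
by rewrite P_size ltnS (leq_trans (leq_pred n)).
Qed.

Lemma moment2 n : L ('X^2 * (P n * P n)) = (b n + b n.+1) * L (P n * P n).
Proof.
have -> : 'X^2 * (P n * P n) = ('X * P n) * ('X * P n) by ring.
rewrite three_term.
set r := P n.-1.
have -> : (P n.+1 + (b n)%:P * r) * (P n.+1 + (b n)%:P * r) = P n.+1 * P n.+1
    + (b n)%:P * ((2 : R)%:P * (r * P n.+1) + (b n)%:P * (r * r)) by ring.
rewrite LD LZ LD !LZ [L (r * P _)]orth_lower; last first.
  by rewrite P_size ltnS (leq_trans (leq_pred n)).
by rewrite !mulr0 add0r rec_coef_norm norm_ratio; ring.
Qed.

Lemma moment3 n : L ('X^3 * (P n * P n.+1)) =
  b n.+1 * L (P n * P n) * (b n + b n.+1 + b n.+2).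
Proof.
have -> : 'X^3 * (P n * P n.+1) = 'X * (('X * P n) * ('X * P n.+1)) by ring.
rewrite !three_term /=.
set r := P n.-1.
have -> : 'X * ((P n.+1 + (b n)%:P * r) * (P n.+2 + (b n.+1)%:P * P n)) =
  'X * (P n.+1 * P n.+2) + ((b n.+1)%:P * ('X * (P n * P n.+1)) +
  ((b n)%:P * ((r * 'X) * P n.+2) + (b n.+1)%:P * ((b n)%:P * ('X * (r * P n))))).
  by ring.
rewrite !(LD, LZ) !moment1 norm_ratio [L (r * 'X * _)]orth_lower; last first.
  rewrite (leq_trans (size_polyMleq _ _)) // size_polyX P_size addn2 /= !ltnS.
  exact: leq_pred.
have -> : b n * L ('X * (r * P n)) = b n * L (P n * P n).
  rewrite /r; case: n {r} => [|n]; first by rewrite rec_coef_p1_0 !mul0r.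
  by rewrite moment1 norm_ratio.
by ring.
Qed.

Lemma moment2_gap n :
  b n * L ('X^2 * (P n.-1 * P n.+1)) = b n * (b n.+1 * L (P n * P n)).
Proof.
case: n => [|n]; first by rewrite rec_coef_p1_0 !mul0r.
congr (_ * _).
have -> : 'X^2 * (P n * P n.+2) = ('X * P n) * ('X * P n.+2) by ring.
rewrite !three_term /=.
have -> : (P n.+1 + (b n)%:P * P n.-1) * (P n.+3 + (b n.+2)%:P * P n.+1) =
  P n.+1 * P n.+3 + ((b n.+2)%:P * (P n.+1 * P n.+1) +
  (b n)%:P * (P n.-1 * P n.+3 + (b n.+2)%:P * (P n.-1 * P n.+1))) by ring.
rewrite !(LD, LZ) [L (P n.+1 * P n.+3)]orth_lower ?P_size //.
have sP m : (n < m)%N -> (size (P n.-1) <= m)%N.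
  by rewrite P_size; apply: leq_ltn_trans; exact: leq_pred.
rewrite [L (P n.-1 * P n.+3)]orth_lower; last by rewrite sP // ltnS leqW.
by rewrite [L (P n.-1 * P n.+1)]orth_lower ?sP //; ring.
Qed.

(** ** Ladder relations *)

Variables (alpha beta K : R).
Local Notation A0 := (ladA0 alpha beta K (p1 P)).
Local Notation A2 := (ladA2 alpha beta K).
Local Notation B1 := (ladB1 alpha beta K (p1 P)).

(** [(1 - x^2) (1 - K x^2)], which clears the poles of [w' / w]. *)
Definition sigma : {poly R} := 1 - (1 + K)%:P * 'X^2 + K%:P * 'X^4.

(** [(sigma w)' / w]. *)
Definition tau : {poly R} :=
  (- 2 * (1 + K) - 2 * (alpha + beta * K))%:P * 'X
  + (4 * K + 2 * K * (alpha + beta))%:P * 'X^3.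

Hypothesis L_pearson : forall f, L (sigma * f^`() + tau * f) = 0.

(** [- sigma w' / w]. *)
Definition potential : {poly R} :=
  (2 * (alpha + beta * K))%:P * 'X - (2 * K * (alpha + beta))%:P * 'X^3.

Definition ladA n : {poly R} := (A0 n)%:P + (A2 n)%:P * 'X^2.

Definition ladB n : {poly R} := (B1 n)%:P * 'X - (n%:R * K)%:P * 'X^3.

Definition lowering n :=
  sigma * (P n)^`() = - ladB n * P n + (b n)%:P * ladA n * P n.-1.

Lemma ladB_succ n : ladB n.+1 = 'X * ladA n - potential - ladB n.
Proof. by rewrite /ladB /ladA /potential /ladA0 /ladA2 -natr1; ring. Qed.

(** Lowering at [n.-1] with [b_(n-1) P_(n-2)] expressed by [P_(n-1)] and
    [P_n].  The factor [b n] makes the relation trivial at [n = 0]. *)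
Lemma raising n : lowering n.-1 ->
  (b n)%:P * (sigma * (P n.-1)^`()) =
  (b n)%:P * ((ladB n + potential) * P n.-1 - ladA n.-1 * P n).
Proof.
case: n => [|n]; first by rewrite rec_coef_p1_0 !mul0r.
rewrite /lowering /= => ->; congr (_ * _).
have -> : (b n)%:P * ladA n * P n.-1 = ladA n * ('X * P n - P n.+1).
  by rewrite three_term; ring.
by rewrite ladB_succ; ring.
Qed.

(** Differentiating the three-term recurrence gives lowering at [n.+1], with
    an explicit constant term in place of [b n.+1 * A0 n.+1].  Testing the
    result against [P n], and lowering at [n] against [P n.+1], shows by the
    Pearson equation that the two agree. *)
Lemma laguerre_freud_step n : lowering n.-1 -> lowering n ->
  b n.+1 * A0 n.+1 - b n * A0 n.-1 = 1 /\ lowering n.+1.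
Proof.
move=> low1 low.
have lowS : sigma * (P n.+1)^`() = - ladB n.+1 * P n.+1
    + ((1 + b n * A0 n.-1)%:P + (b n.+1 * A2 n.+1)%:P * 'X^2) * P n.
  have E : P n.+1 = 'X * P n - (b n)%:P * P n.-1 by rewrite three_term addrK.
  rewrite {1}E derivB !derivM derivX derivC mul0r add0r mul1r.
  have -> : sigma * (P n + 'X * (P n)^`() - (b n)%:P * (P n.-1)^`()) =
     sigma * P n + 'X * (sigma * (P n)^`()) - (b n)%:P * (sigma * (P n.-1)^`()).
    by ring.
  rewrite raising // low E.
  have -> : (1 + b n * A0 n.-1)%:P + (b n.+1 * A2 n.+1)%:P * 'X^2 =
     sigma + 'X * (ladB n.+1 - ladB n) + (b n)%:P * ladA n.-1 :> {poly R}.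
    have -> : (b n)%:P * ladA n.-1 =
        (b n * A0 n.-1)%:P + (b n * (A2 n + 2 * K))%:P * 'X^2 :> {poly R}.
      case: n {low low1 E} => [|n]; first by rewrite rec_coef_p1_0 !mul0r; ring.
      by rewrite /ladA /ladA2 /= -natr1; ring.
    rewrite /sigma /ladB /ladB1 /rec_coef /ladA2 -!natr1.
    by move: (A0 _) => z; ring.
  by rewrite ladB_succ; ring.
have h0 : L (P n * P n) != 0.
  by apply/eqP => /L_definite E; have := P_size n; rewrite E size_poly0.
have LF : 1 + b n * A0 n.-1 = b n.+1 * A0 n.+1.
  have := L_pearson (P n * P n.+1).
  rewrite derivM mulrDr mulrA [sigma * (P n * _)]mulrCA low lowS.
  pose r := P n.-1.
  have -> : (- ladB n * P n + (b n)%:P * ladA n * P n.-1) * P n.+1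
    + P n * (- ladB n.+1 * P n.+1
      + ((1 + b n * A0 n.-1)%:P + (b n.+1 * A2 n.+1)%:P * 'X^2) * P n)
    + tau * (P n * P n.+1) =
    (- B1 n - B1 n.+1 - 2 * (1 + K) - 2 * (alpha + beta * K))%:P
      * ('X * (P n * P n.+1))
    + (((2 * n%:R + 5) * K + 2 * K * (alpha + beta))%:P * ('X^3 * (P n * P n.+1))
    + ((A0 n)%:P * ((b n)%:P * (r * P n.+1))
    + ((A2 n)%:P * ((b n)%:P * ('X^2 * (r * P n.+1)))
    + ((1 + b n * A0 n.-1)%:P * (P n * P n)
    + (b n.+1 * A2 n.+1)%:P * ('X^2 * (P n * P n)))))) :> {poly R}.
    rewrite /ladB /ladA /tau -/r -!natr1.
    by move: (A0 _) (A0 _) (B1 _) (B1 _) (A2 _) (A2 _) => z1 z2 z3 z4 z5 z6; ring.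
  rewrite !(LD, LZ) moment1 moment2 moment2_gap moment3.
  rewrite [L (r * P n.+1)]orth_lower; last first.
    by rewrite P_size ltnS (leq_trans (leq_pred n)).
  move=> H; apply: (mulIf h0); apply/eqP; rewrite -subr_eq0 -H; apply/eqP.
  move: (ladA0 _ _ _ _ n.-1) => z.
  by rewrite /ladA0 /ladB1 /ladA2 /rec_coef -!natr1; ring.
split; first by rewrite -LF addrK.
by rewrite /lowering lowS LF /ladA; ring.
Qed.

Lemma lowering_all n : lowering n.-1 /\ lowering n.
Proof.
elim: n => [|n [low1 low]] /=; last first.
  by split=> //; have [] := laguerre_freud_step low1 low.
suff low0 : lowering 0 by [].
have E : P 0 = 1.
  by rewrite (size1_polyC (eq_leq (P_size 0))) coef_lead.
rewrite /lowering E derivC mulr0 rec_coef_p1_0 mul0r mul0r addr0 mulr1.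
by rewrite /ladB /ladB1 rec_coef_p1_0 /p1 /=; ring.
Qed.

Lemma laguerre_freud n : b n.+1 * A0 n.+1 - b n * A0 n.-1 = 1.
Proof. by have [l1 l2] := lowering_all n; have [] := laguerre_freud_step l1 l2. Qed.

End OrthogonalPolynomials.

(** * Integrals over ]-1, 1[ as limits of integrals over compact intervals *)

Section Truncation.
Variable R : realType.
Local Notation mu := (@lebesgue_measure R).
Local Notation D := (`](-1 : R), 1[).

Definition trunc_end (n : nat) : R := 1 - n.+2%:R^-1.
Local Notation E n := (`[- trunc_end n, trunc_end n]).

Lemma trunc_end_gt0 n : 0 < trunc_end n.
Proof. by rewrite subr_gt0 invf_lt1 ?ltr0n // ltr1n. Qed.

Lemma trunc_end_lt1 n : trunc_end n < 1.
Proof. by rewrite ltrBlDr ltrDl invr_gt0 ltr0n. Qed.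

Lemma cvg_trunc_end : trunc_end @ \oo --> (1 : R).
Proof.
rewrite -[X in _ --> X]subr0; apply: cvgB; first exact: cvg_cst.
have := @cvg_harmonic R; rewrite -(cvg_shiftS) /=; apply.
Qed.

Lemma trunc_itv_sub n : [set` E n] `<=` [set` D].
Proof.
apply: subset_itvSoo; rewrite bnd_simp ?trunc_end_lt1 //.
by rewrite ltrN2 trunc_end_lt1.
Qed.

Lemma trunc_itv_near x : x \in D -> \forall n \near \oo, x \in E n.
Proof.
rewrite in_itv /= => /andP[x1 x2].
have H : `|x| < 1 by rewrite ltr_norml x1 x2.
near=> n; rewrite in_itv /= -ler_norml; apply/ltW.
by near: n; exact: (cvgr_gt _ cvg_trunc_end).
Unshelve. all: by end_near. Qed.

Lemma bigcup_trunc : \bigcup_n [set` E n] = [set` D].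
Proof.
apply/seteqP; split=> [x [n _]|x /= xD]; first exact: trunc_itv_sub.
by have [N _ /(_ N (leqnn N))] := trunc_itv_near xD; exists N.
Qed.

Lemma trunc_itv_mono : nondecreasing_seq (fun n => [set` E n]).
Proof.
apply/nondecreasing_seqP => n; rewrite subsetEset.
have le : trunc_end n <= trunc_end n.+1.
  by rewrite lerD2l lerN2 lef_pV2 ?posrE ?ltr0n // ler_nat.
by apply: subset_itv; rewrite bnd_simp // lerN2.
Qed.

Implicit Type g : R -> R.

Lemma measurable_continuous_oo g : {in D, continuous g} ->
  measurable_fun [set` D] g.
Proof.
move=> cg; apply: open_continuous_measurable_fun; first exact: interval_open.
by move=> x; rewrite inE /=; exact: cg.
Qed.

Lemma integrable_trunc g n : {in D, continuous g} ->
  mu.-integrable [set` E n] (EFin \o g).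
Proof.
move=> cg; apply: continuous_compact_integrable; first exact: segment_compact.
apply: continuous_in_subspaceT => x; rewrite inE /= => /trunc_itv_sub; exact: cg.
Qed.

Lemma integrable_of_trunc_bound g M : {in D, continuous g} ->
  {in D, forall x, 0 <= g x} ->
  (forall n, \int[mu]_(x in [set` E n]) g x <= M) ->
  mu.-integrable [set` D] (EFin \o g).
Proof.
move=> cg g0 gM; apply/integrableP; split.
  by apply/measurable_EFinP; exact: measurable_continuous_oo.
apply: (@le_lt_trans _ _ M%:E); last exact: ltry.
have -> : (\int[mu]_(x in [set` D]) `|(EFin \o g) x| =
    \int[mu]_(x in [set` D]) (EFin \o g) x)%E.
  by apply: eq_integral => x; rewrite inE /= => xD; rewrite ger0_norm // g0.
have gE n x : [set` E n] x -> (0 <= (EFin \o g) x)%E.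
  by move=> /trunc_itv_sub xD; rewrite lee_fin g0.
have mE n : measurable_fun [set` E n] (EFin \o g).
  by have /integrableP[] := integrable_trunc n cg.
have := @ge0_nondecreasing_set_cvg_integral _ (measurableTypeR R) _
  (fun n => [set` E n]) (EFin \o g) mu trunc_itv_mono
  (fun n => measurable_itv _) mE gE.
rewrite bigcup_trunc => cvgI; rewrite -(cvg_lim _ cvgI) //.
apply: lime_le; first by apply/cvg_ex; eexists; exact: cvgI.
apply: nearW => n; have := gM n; rewrite -lee_fin /Rintegral fineK //.
by apply: integrable_fin_num => //; exact: integrable_trunc.
Qed.

Lemma cvg_Rintegral_trunc g : {in D, continuous g} ->
  mu.-integrable [set` D] (EFin \o g) ->
  \int[mu]_(x in [set` E n]) g x @[n --> \oo] --> \int[mu]_(x in [set` D]) g x.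
Proof.
move=> cg ig.
have mg := measurable_int mu ig.
have mT n : measurable_fun [set` D] ((EFin \o g) \_ [set` E n]).
  apply/measurable_restrict => //.
  by apply: measurable_funS mg => // x [].
have cT : {ae mu, forall x, [set` D] x ->
    ((EFin \o g) \_ [set` E n]) x @[n --> \oo] --> (EFin \o g) x}.
  apply: aeW => x /= xD; apply: cvg_near_cst.
  near=> n; rewrite patchE mem_set //=; near: n; exact: trunc_itv_near.
have bT : {ae mu, forall x n, [set` D] x ->
    (`| ((EFin \o g) \_ [set` E n]) x | <= (abse \o (EFin \o g)) x)%E}.
  by apply: aeW => x n _; rewrite patchE; case: ifP => //= _; rewrite normr0 lee_fin.
have [_ _ +] := @dominated_convergence _ (measurableTypeR R) _ mu _
  (measurable_itv _) _ _ _ mT mg cT (integrable_abse ig) bT.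
have -> : [sequence (\int[mu]_(x in [set` D]) ((EFin \o g) \_ [set` E n]) x)%E]_n
   = (fun n => (\int[mu]_(x in [set` E n]) g x)%:E).
  apply/funext => n /=; rewrite -integral_mkcondr setIidr; last exact: trunc_itv_sub.
  by rewrite /Rintegral fineK //; apply: integrable_fin_num => //; exact: integrable_trunc.
rewrite -[X in _ --> X]fineK; last exact: integrable_fin_num.
exact: fine_cvg.
Unshelve. all: by end_near. Qed.

End Truncation.

(** * The functional of the weight *)

Lemma is_derive_powR_horner (R : realType) (q : {poly R}) (a x : R) :
  0 < q.[x] ->
  is_derive x 1 (fun y => q.[y] `^ a) (a * q.[x] `^ (a - 1) * q^`().[x]).
Proof.
by move=> q0; exact: is_derive1_comp (is_derive1_powR a q0) (is_derive_poly q x).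
Qed.

Lemma continuous_powR_horner (R : realType) (q : {poly R}) (a x : R) :
  0 < q.[x] -> {for x, continuous (fun y => q.[y] `^ a)}.
Proof.
move=> q0; apply: differentiable_continuous; apply/derivable1_diffP.
by have [] := is_derive_powR_horner a q0.
Qed.

(** The two summands bound the power for nonnegative and negative exponents. *)
Lemma powR_bound (R : realType) (a b y : R) : 0 < a -> a <= y <= 1 ->
  y `^ b <= 1 + a `^ b.
Proof.
move=> a0 /andP[ay y1]; have y0 := lt_le_trans a0 ay.
have [b0|b0] := leP 0 b.
  have E1 : (1 : R) `^ b = 1 by rewrite powR1.
  rewrite -[y `^ b]addr0 lerD ?powR_ge0 // -E1.
  by apply: ge0_ler_powR; rewrite ?nnegrE ?ler01 ?(ltW y0).
rewrite -[y `^ b]add0r lerD ?ler01 // -[b]opprK !(powRN _ (- b)).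
rewrite lef_pV2 ?posrE ?powR_gt0 //.
by apply: ge0_ler_powR; rewrite ?nnegrE ?(ltW a0) ?(ltW y0) // oppr_ge0 ltW.
Qed.

Lemma horner_bounded_cc (R : realFieldType) (q : {poly R}) :
  exists M, forall x, `|x| <= 1 -> `|q.[x]| <= M.
Proof.
elim/poly_ind: q => [|q c [M IH]].
  by exists 0 => x _; rewrite horner0 normr0.
exists (M + `|c|) => x x1; rewrite hornerMXaddC (le_trans (ler_normD _ _)) // lerD2r.
by rewrite normrM (le_trans _ (IH x x1)) // ler_piMr.
Qed.

Section Weight.
Variables (R : realType) (alpha beta k : R).
Hypotheses (halpha : -1 < alpha) (hk : 0 < k ^+ 2 < 1).
Local Notation mu := (@lebesgue_measure R).
Local Notation D := (`](-1 : R), 1[).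
Local Notation E n := (`[- trunc_end R n, trunc_end R n]).
Local Notation K := (k ^+ 2).
Local Notation w := (weight alpha beta k).
Local Notation sg := (sigma K).
Local Notation ta := (tau alpha beta K).

Definition edge_poly : {poly R} := 1 - 'X^2.
Definition inner_poly : {poly R} := 1 - K%:P * 'X^2.

Lemma weightE x : w x = edge_poly.[x] `^ alpha * inner_poly.[x] `^ beta.
Proof. by rewrite /weight !hornerE. Qed.

Lemma edge_poly_gt0 x : x \in D -> 0 < edge_poly.[x].
Proof.
have -> : edge_poly.[x] = (1 - x) * (1 + x) by rewrite /edge_poly !hornerE /=; ring.
by rewrite in_itv /= => /andP[? ?]; rewrite mulr_gt0; lra.
Qed.

Lemma edge_poly_le1 x : edge_poly.[x] <= 1.
Proof. by rewrite /edge_poly !hornerE /= lerBlDl lerDr sqr_ge0. Qed.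

Lemma edge_polyN x : edge_poly.[- x] = edge_poly.[x].
Proof. by rewrite /edge_poly !hornerE /=; ring. Qed.

Lemma inner_polyE x : inner_poly.[x] = (1 - K) + K * edge_poly.[x].
Proof. by rewrite /edge_poly /inner_poly !hornerE /=; ring. Qed.

Lemma inner_poly_itv x : x \in D -> 1 - K <= inner_poly.[x] <= 1.
Proof.
move=> /edge_poly_gt0 q10; have /andP[k0 _] := hk; have := edge_poly_le1 x.
rewrite inner_polyE => q11; apply/andP; split; first by rewrite lerDl mulr_ge0 // ltW.
by rewrite -[leRHS](subrK K) lerD2l ler_piMr // ltW.
Qed.

Lemma inner_poly_gt0 x : x \in D -> 0 < inner_poly.[x].
Proof.
move=> /inner_poly_itv /andP[+ _]; apply: lt_le_trans.
by have /andP[_ k1] := hk; rewrite subr_gt0.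
Qed.

Lemma weight_gt0 x : x \in D -> 0 < w x.
Proof. by move=> xD; rewrite weightE mulr_gt0 ?powR_gt0 ?edge_poly_gt0 ?inner_poly_gt0. Qed.

Lemma weight_even x : w (- x) = w x.
Proof. by rewrite /weight sqrrN. Qed.

Lemma continuous_poly_weight (p : {poly R}) :
  {in D, continuous (fun x => p.[x] * w x)}.
Proof.
move=> x xD.
have -> : (fun x => p.[x] * w x)
    = (fun x => p.[x] * (edge_poly.[x] `^ alpha * inner_poly.[x] `^ beta)).
  by apply/funext => y; rewrite weightE.
apply: cvgM; first exact: continuous_horner.
apply: cvgM; apply: continuous_powR_horner; [exact: edge_poly_gt0|exact: inner_poly_gt0].
Qed.

(** [f sigma w], written so that it vanishes at [1] and [-1]. *)
Definition boundary (f : {poly R}) x :=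
  f.[x] * (edge_poly.[x] `^ (alpha + 1) * inner_poly.[x] `^ (beta + 1)).

Lemma is_derive_boundary f x : x \in D ->
  is_derive x 1 (boundary f) ((sg * f^`() + ta * f).[x] * w x).
Proof.
move=> xD; have q10 := edge_poly_gt0 xD; have q20 := inner_poly_gt0 xD.
have d1 := is_derive_powR_horner (alpha + 1) q10.
have d2 := is_derive_powR_horner (beta + 1) q20.
have d4 := is_deriveM (is_derive_poly f x) (is_deriveM d1 d2).
apply: (is_derive_eq d4).
have dq1 : edge_poly^`().[x] = - (2 * x).
  by rewrite /edge_poly derivB -[1]/(1%:P) derivC derivXn /= !hornerE /=; ring.
have dq2 : inner_poly^`().[x] = - (2 * K * x).
  by rewrite /inner_poly derivB -[1]/(1%:P) derivM !derivC derivXn /= !hornerE /=; ring.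
rewrite !fctE dq1 dq2 !addrK.
rewrite !powRD ?(lt0r_neq0 q10) ?(lt0r_neq0 q20) ?implybT //.
rewrite !powRr1 ?(ltW q10) ?(ltW q20) // weightE.
move: (edge_poly.[x] `^ alpha) (inner_poly.[x] `^ beta) => z1 z2.
rewrite /sigma /tau /edge_poly /inner_poly /GRing.scale /=.
by rewrite !hornerE /=; ring.
Qed.

Lemma Rintegral_boundary f c : 0 < c < 1 ->
  \int[mu]_(x in `[-c, c]) ((sg * f^`() + ta * f).[x] * w x)
   = boundary f c - boundary f (- c).
Proof.
move=> /andP[c0 c1].
have sub x : x \in `[-c, c] -> x \in D.
  by rewrite !in_itv /= => /andP[? ?]; apply/andP; split; lra.
have cb x : x \in `[-c, c] -> {for x, continuous (boundary f)}.
  move=> /sub xD; apply: differentiable_continuous; apply/derivable1_diffP.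
  by have [] := is_derive_boundary f xD.
rewrite /Rintegral (@continuous_FTC2 _ _ (boundary f)) //.
- by lra.
- apply: continuous_in_subspaceT => x; rewrite inE /= => /sub.
  exact: continuous_poly_weight.
- split.
  + move=> x xc; have xD : x \in D by apply: sub; exact: subset_itv_oo_cc.
    by have [] := is_derive_boundary f xD.
  + by apply: cvg_at_right_filter; apply: cb; rewrite in_itv /=; lra.
  + by apply: cvg_at_left_filter; apply: cb; rewrite in_itv /=; lra.
- move=> x xc; have xD : x \in D by apply: sub; exact: subset_itv_oo_cc.
  by rewrite derive1E; have [] := is_derive_boundary f xD.
Qed.

Lemma edge_weight_bound x : x \in D -> edge_poly.[x] * w x <= 1 + (1 - K) `^ beta.
Proof.
move=> xD; have q10 := edge_poly_gt0 xD; have /andP[_ k1] := hk.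
rewrite weightE mulrA -[X in X * _ * _]powRr1 ?(ltW q10) // -powRD; last first.
  by rewrite (lt0r_neq0 q10) implybT.
have a1 : 0 < 1 + alpha by rewrite addrC -ltrBlDr sub0r.
rewrite -[leRHS]mul1r ler_pM ?powR_ge0 //.
  have E1 : (1 : R) `^ (1 + alpha) = 1 by rewrite powR1.
  rewrite -[leRHS]E1; apply: ge0_ler_powR; rewrite ?nnegrE ?(ltW a1) ?(ltW q10) //.
  exact: edge_poly_le1.
by apply: powR_bound; rewrite ?subr_gt0 // inner_poly_itv.
Qed.

Lemma boundary_X_ge0 c : 0 < c < 1 -> 0 <= boundary 'X c - boundary 'X (- c).
Proof.
move=> /andP[c0 _]; rewrite /boundary !hornerX !inner_polyE edge_polyN mulNr opprK.
by rewrite addr_ge0 // !mulr_ge0 ?powR_ge0 // ltW.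
Qed.

(** Integrability at the ends comes from the antiderivative [x sigma w]: its
    derivative is [(sigma + x tau) w], and [sigma + x tau] takes the negative
    value [- C] at both ends, so that [C w = - (x sigma w)' + O ((1 - x^2) w)].  The
    last term is bounded because [alpha > -1], and the boundary terms of the
    first one have the good sign. *)
Lemma integrable_poly_weight p :
  mu.-integrable [set` D] (EFin \o (fun x => p.[x] * w x)).
Proof.
have /andP[k0 k1] := hk.
pose C := 2 * (1 + alpha) * (1 - K).
have C0 : 0 < C by rewrite !mulr_gt0 // ?subr_gt0 // addrC -ltrBlDr sub0r.
have iC : mu.-integrable [set` D] (EFin \o (fun x => (C%:P).[x] * w x)).
  (* C + sigma + x tau = (A + B x^2) (1 - x^2) *)
  pose A := 1 + C; pose B := - (5 * K + 2 * K * (alpha + beta)).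
  pose N := (`|A| + `|B|) * (1 + (1 - K) `^ beta).
  have H x : x \in D -> C%:P.[x] * w x <= N - (sg * ('X)^`() + ta * 'X).[x] * w x.
    move=> xD; rewrite lerBrDr -mulrDl.
    have -> : C%:P.[x] + (sg * ('X)^`() + ta * 'X).[x] = (A + B * x ^+ 2) * edge_poly.[x].
      by rewrite /sigma /tau /edge_poly derivX !hornerE /= /A /B /C; ring.
    have x2 : x ^+ 2 <= 1.
      by have := ltW (edge_poly_gt0 xD); rewrite /edge_poly !hornerE /= subr_ge0 expr2.
    have q0 : 0 <= edge_poly.[x] * w x.
      by rewrite mulr_ge0 // ltW // ?edge_poly_gt0 ?weight_gt0.
    rewrite -mulrA (@le_trans _ _ ((`|A| + `|B|) * (edge_poly.[x] * w x))) //.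
      rewrite ler_wpM2r // lerD ?ler_norm // (le_trans (ler_norm _)) //.
      by rewrite normrM ler_piMr // ger0_norm // sqr_ge0.
    by rewrite ler_wpM2l ?addr_ge0 // edge_weight_bound.
  apply: (@integrable_of_trunc_bound _ _ (2 * N)).
  - exact: continuous_poly_weight.
  - by move=> x xD; rewrite hornerC mulr_ge0 ?(ltW C0) // ltW // weight_gt0.
  - move=> n.
    have c01 : 0 < trunc_end R n < 1 by rewrite trunc_end_gt0 trunc_end_lt1.
    have iN : mu.-integrable [set` E n] (EFin \o cst N).
      by apply: integrable_trunc => x _; exact: cvg_cst.
    have ig := integrable_trunc n (@continuous_poly_weight (sg * ('X)^`() + ta * 'X)).
    have le1 : \int[mu]_(x in [set` E n]) (C%:P.[x] * w x) <=
        \int[mu]_(x in [set` E n]) (N - (sg * ('X)^`() + ta * 'X).[x] * w x).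
      apply: le_Rintegral => //.
      + by apply: integrable_trunc; exact: continuous_poly_weight.
      + apply: integrable_trunc => x xD; apply: cvgB; first exact: cvg_cst.
        exact: continuous_poly_weight.
      + by move=> x /trunc_itv_sub; exact: H.
    apply: (le_trans le1).
    rewrite RintegralB // Rintegral_boundary // lerBlDr.
    apply: (@le_trans _ _ (2 * N)); last by rewrite lerDl boundary_X_ge0.
    have muE : fine (lebesgue_measure [set` E n]) = trunc_end R n + trunc_end R n.
      by rewrite lebesgue_measure_itv /= lte_fin gtrN ?trunc_end_gt0 //= opprK.
    rewrite Rintegral_cst // [X in N * X](_ : _ = trunc_end R n + trunc_end R n) //.
    rewrite mulrC ler_wpM2r //; first by rewrite mulr_ge0 ?addr_ge0 ?powR_ge0.
    by have := ltW (trunc_end_lt1 R n); lra.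
have [M HM] := horner_bounded_cc p.
have iMC := @integrableZl _ (measurableTypeR R) _ mu _ (measurable_itv _) (M / C) _ iC.
apply: le_integrable iMC => //.
  apply/measurable_EFinP; apply: measurable_continuous_oo.
  exact: continuous_poly_weight.
have E1 y : M / C * (C * y) = M * y by field; rewrite gt_eqF.
move=> x /= xD; rewrite lee_fin hornerC E1.
have w0 := weight_gt0 xD.
rewrite !normrM ler_wpM2r // (le_trans (HM x _)) ?ler_norm //.
by rewrite ltW // ltr_norml; move: xD; rewrite in_itv.
Qed.

Definition wint (p : {poly R}) : R := \int[mu]_(x in [set` D]) (p.[x] * w x).

Lemma wprodE p q : wprod alpha beta k p q = wint (p * q).
Proof.
rewrite /wprod /wint.
have -> : (fun x => p.[x] * q.[x] * w x) = (fun x => (p * q).[x] * w x).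
  by apply/funext => x; rewrite hornerM.
rewrite /Rintegral integral_itv_bndoo //.
apply/measurable_EFinP; apply: measurable_continuous_oo.
exact: continuous_poly_weight.
Qed.

Lemma wintD p q : wint (p + q) = wint p + wint q.
Proof.
rewrite -RintegralD //; try exact: integrable_poly_weight.
by congr Rintegral; apply/funext => x; rewrite hornerD mulrDl.
Qed.

Lemma wintZ c p : wint (c%:P * p) = c * wint p.
Proof.
rewrite -RintegralZl //; try exact: integrable_poly_weight.
by congr Rintegral; apply/funext => x; rewrite hornerCM -mulrA.
Qed.

Lemma cvg_wint p :
  \int[mu]_(x in [set` E n]) (p.[x] * w x) @[n --> \oo] --> wint p.
Proof.
apply: cvg_Rintegral_trunc; first exact: continuous_poly_weight.
exact: integrable_poly_weight.
Qed.

Lemma wint_even p : wint (p \Po - 'X) = wint p.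
Proof.
rewrite -(cvg_lim _ (@cvg_wint (p \Po - 'X))) // -(cvg_lim _ (@cvg_wint p)) //.
have H n : \int[mu]_(x in [set` E n]) ((p \Po - 'X).[x] * w x) =
    \int[mu]_(x in [set` E n]) (p.[x] * w x).
  have c0 := trunc_end_gt0 R n.
  rewrite /Rintegral; congr fine.
  have := @integration_by_substitution_oppr R (fun x => p.[x] * w x)
    (- trunc_end R n) (trunc_end R n).
  rewrite opprK => ->.
  - apply: eq_integral => x _.
    by rewrite /= horner_comp hornerN hornerX weight_even.
  - by lra.
  - apply: continuous_in_subspaceT => x; rewrite inE /= => /trunc_itv_sub.
    exact: continuous_poly_weight.
by under eq_fun do rewrite H.
Qed.

(** The exponent [alpha + 1] of the vanishing factor is positive, and the
    other factors stay bounded. *)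
Lemma boundary_cvg0 f (u : R^nat) : (forall n, u n \in D) ->
  edge_poly.[u n] @[n --> \oo] --> 0 -> boundary f (u n) @[n --> \oo] --> 0.
Proof.
move=> uD u1; have /andP[_ k1] := hk.
have a1 : 0 < alpha + 1 by rewrite -ltrBlDr sub0r.
have [M HM] := horner_bounded_cc f.
pose N := M * (1 + (1 - K) `^ (beta + 1)).
have cp : edge_poly.[u n] `^ (alpha + 1) @[n --> \oo] --> 0.
  have /cvg_at_rightP := @powR_cvg0 R _ a1.
  by apply; split=> // n; exact: edge_poly_gt0.
have cN : N * edge_poly.[u n] `^ (alpha + 1) @[n --> \oo] --> 0.
  by rewrite -(mulr0 N); apply: cvgM => //; exact: cvg_cst.
apply/norm_cvg0P; apply: (squeeze_cvgr _ (cvg_cst 0) cN).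
apply: nearW => n; rewrite normr_ge0 /= /boundary !normrM.
rewrite !(ger0_norm (powR_ge0 _ _)) /N -mulrA [X in _ <= _ * X]mulrC.
have uDn := uD n; have u1n : `|u n| <= 1.
  by rewrite ltW // ltr_norml; move: uDn; rewrite in_itv.
rewrite ler_pM ?mulr_ge0 ?powR_ge0 //; first exact: HM.
rewrite ler_wpM2l ?powR_ge0 //; apply: powR_bound; first by rewrite subr_gt0.
exact: inner_poly_itv.
Qed.

Lemma wint_pearson f : wint (sg * f^`() + ta * f) = 0.
Proof.
have H : (fun n => \int[mu]_(x in [set` E n]) ((sg * f^`() + ta * f).[x] * w x)) =
    (fun n => boundary f (trunc_end R n) - boundary f (- trunc_end R n)).
  by apply/funext => n; rewrite Rintegral_boundary // trunc_end_gt0 trunc_end_lt1.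
rewrite -(cvg_lim _ (@cvg_wint _)) // H; apply: cvg_lim => //.
have q1c : edge_poly.[trunc_end R n] @[n --> \oo] --> 0.
  have -> : 0 = edge_poly.[1] by rewrite /edge_poly !hornerE /=; ring.
  by apply: continuous_cvg; [exact: continuous_horner|exact: cvg_trunc_end].
have tD n : trunc_end R n \in D.
  by have := trunc_end_gt0 R n; have := trunc_end_lt1 R n; rewrite in_itv /=; lra.
have tND n : - trunc_end R n \in D.
  by have := trunc_end_gt0 R n; have := trunc_end_lt1 R n; rewrite in_itv /=; lra.
rewrite -[X in _ --> X](subr0 0); apply: cvgB; apply: boundary_cvg0 => //.
have -> : (fun n => edge_poly.[- trunc_end R n]) = (fun n => edge_poly.[trunc_end R n]).
  by apply/funext => n; exact: edge_polyN.
exact: q1c.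
Qed.

(** If the integral of [p^2 w] vanishes, then [p] vanishes almost everywhere
    on the interval, hence at infinitely many points. *)
Lemma wint_definite p : wint (p * p) = 0 -> p = 0.
Proof.
move=> p0; apply/eqP/negPn/negP => pN0.
have ip := integrable_poly_weight (p * p).
have mp := measurable_int mu ip.
have : (\int[mu]_(x in [set` D])
    `|(EFin \o (fun x => ((p * p).[x] * w x)%R)) x|)%E = 0%E.
  have -> : (\int[mu]_(x in [set` D]) `|(EFin \o (fun x => ((p * p).[x] * w x)%R)) x|
      = \int[mu]_(x in [set` D]) ((p * p).[x] * w x)%R%:E)%E.
    apply: eq_integral => x; rewrite inE /= => xD; rewrite ger0_norm // hornerM.
    by rewrite -expr2 mulr_ge0 ?sqr_ge0 // ltW // weight_gt0.
  by rewrite -[LHS]fineK ?(integrable_fin_num _ ip) // -[fine _]/(wint (p * p)) p0.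
move/(@ae_eq_integral_abs _ (measurableTypeR R) _ mu _ (measurable_itv _) _ mp).
move=> [N [mN N0 subN]].
have mDN : measurable ([set` D] `\` N) by exact: measurableD.
have [fin|inf] := pselect (finite_set ([set` D] `\` N)).
  have mDN0 : lebesgue_measure ([set` D] `\` N) = 0%E.
    by apply: countable_lebesgue_measure0; exact: finite_set_countable.
  have : (lebesgue_measure [set` D] <= 0 :> \bar R)%E.
    rewrite -[leRHS]adde0 -{1}N0 -mDN0.
    apply: (@le_trans _ _ (lebesgue_measure (N `|` ([set` D] `\` N)))).
      apply: le_measure; rewrite ?inE //; first exact: measurableU.
      by move=> x xD; have [xN|xN] := pselect (N x); [left|right].
    exact: measureU2.
  by rewrite lebesgue_measure_itv /= lte_fin gtrN ?ltr01 //= lee_fin; lra.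
have [B BD sB] := infinite_set_fset (size p) inf.
have rB : all (root p) (finmap.enum_fset B).
  apply/allP => x xB; have [xD xN] := BD _ xB.
  apply/negPn/negP => px; apply: xN; apply: subN => H.
  have : 0 < (p * p).[x] * w x.
    rewrite hornerM -expr2 mulr_gt0 ?weight_gt0 //.
    by rewrite lt_neqAle sqr_ge0 eq_sym sqrf_eq0 andbT.
  by case: (H xD) => ->; rewrite ltxx.
by have := max_poly_roots pN0 rB (finmap.fset_uniq B); rewrite ltnNge sB.
Qed.

End Weight.

(** * The difference equation *)

(* The case n = 0 is excluded because p1 (n - 1) is then undefined.
   In the source the two lines of cubic terms marked below read
     k^4 (s - 3/2) (s + 1/2)^2 (pp^2 (p - pm) - pm^2 (p - pp))
     (s + 1/2) (s - 3/2) k^4 pp p pm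
   with s = alpha + beta + n and pm, p, pp = p1 (n - 1), p1 n, p1 (n + 1).
   With these the equation fails: for alpha = beta = 0 and n = 3 (Legendre;
   pm, p, pp = -1/3, -3/5, -6/7) its right-hand side is (3/5) k^4.  *)
Theorem theorem1p5 (R : realType) (alpha beta k : R) (P : nat -> {poly R})
    (n : nat) (halpha : -1 < alpha) (hk : 0 < k ^+ 2 < 1)
    (hP : monic_orthogonal alpha beta k P) (hn : (1 <= n)%N) :
  0 =
    (* corrected *)
    k ^+ 4 * (alpha + beta + n%:R - 3 / 2) * (alpha + beta + n%:R + 1 / 2)
      * ((alpha + beta + n%:R + 1 / 2)
           * p1 P n.+1 ^+ 2 * (p1 P n - p1 P n.-1)
         - (alpha + beta + n%:R - 3 / 2)
           * p1 P n.-1 ^+ 2 * (p1 P n - p1 P n.+1))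
  + (alpha + beta + n%:R - 1 / 2) ^+ 2
      * (k ^+ 2 * (alpha + beta + n%:R - 3 / 2) * p1 P n.-1
         - k ^+ 2 * (alpha + beta + n%:R + 1 / 2) * p1 P n.+1
         - (beta + n%:R - 1 / 2) * k ^+ 2 - alpha - n%:R + 1 / 2)
      * k ^+ 2 * p1 P n ^+ 2
    (* corrected *)
  + 2 * (alpha + beta + n%:R + 1 / 2) * (alpha + beta + n%:R - 3 / 2) * k ^+ 4
      * p1 P n.+1 * p1 P n * p1 P n.-1
  + k ^+ 2 * (alpha + beta + n%:R + 1 / 2) * (alpha + beta + n%:R - 3 / 2)
      * ((beta + n%:R - 1 / 2) * k ^+ 2 + alpha + n%:R - 1 / 2)
      * (p1 P n.+1 * p1 P n + p1 P n * p1 P n.-1 - p1 P n.+1 * p1 P n.-1)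
  + (alpha * k ^+ 2 + beta)
      * ((alpha + beta + n%:R + 1 / 2) * p1 P n.+1
         - (alpha + beta + n%:R - 3 / 2) * p1 P n.-1)
      * k ^+ 2 * p1 P n
  + (n%:R - 1) / 2 * (alpha + beta + n%:R + 1 / 2)
      * (alpha + beta + n%:R / 2 - 1 / 2) * k ^+ 2 * p1 P n.+1
  - n%:R / 2 * (alpha + beta + n%:R - 3 / 2)
      * (alpha + beta + n%:R / 2) * k ^+ 2 * p1 P n.-1
  + (alpha * (beta + n%:R - 1 / 2) * k ^+ 4
     + 1 / 2 * (alpha - beta + n%:R - 1 / 2)
         * (alpha - beta - n%:R + 1 / 2) * k ^+ 2
     + beta * (alpha + n%:R - 1 / 2)) * p1 P n
  + 1 / 4 * n%:R * (n%:R - 1) * (alpha * k ^+ 2 + beta).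
Proof.
have [PP [h Ph]] := hP.
have LF : forall m, rec_coef (p1 P) m.+1 * ladA0 alpha beta (k ^+ 2) (p1 P) m.+1
    - rec_coef (p1 P) m * ladA0 alpha beta (k ^+ 2) (p1 P) m.-1 = 1.
  apply: (laguerre_freud (wintD beta halpha hk) (wintZ beta halpha hk)
    (wint_even beta halpha hk) (wint_definite halpha hk) _ _ _
    (wint_pearson beta halpha hk)).
  - by move=> m; have [] := PP m.
  - by move=> m; have [] := PP m.
  - by move=> i j ij; rewrite -wprodE // Ph (negbTE ij) mulr0.
have p_0 : p1 P 0 = 0 by [].
have p_1 : p1 P 1 = 0 by [].
have := ladder_elimination p_0 p_1 LF n.
have -> : k ^+ 4 = (k ^+ 2) ^+ 2 by rewrite -exprM.
have K0 : k ^+ 2 != 0 by have /andP[/lt0r_neq0] := hk.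
move: (k ^+ 2) K0 => K K0.
case: n hn => // n _.
rewrite /scaled_sumA0 /ladA0 /ladB1 /ladA2 /rec_coef /sumA2 /= -[n.+1%:R]natr1.
move: (p1 P n) (p1 P n.+1) (p1 P n.+2) (n%:R) => pm p pp N /eqP.
rewrite -subr_eq0 => /eqP E.
have K8 : 8 * K ^+ 2 != 0 by rewrite mulf_neq0 ?expf_neq0 // pnatr_eq0.
apply: (mulfI K8); rewrite mulr0 -E.
by field.
Qed.
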